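(* Let $\Delta\neq 1$ be a fundamental discriminant and let $X>0$. Let $\mathcal{C}(X)$ be the class of functions $g:[0,\infty)\to\mathbb{R}$ that are continuous, supported on $[0,X]$, satisfy $g(0)=1$, and have non-negative cosine transform $h(t)=2\int_0^\infty g(x)\cos(tx)\,dx$ (for all real $t$). For $g\in\mathcal{C}(X)$ define $$l(g)=2\sum_{n=1}^{\infty}\frac{\Lambda(n)\chi_\Delta(n)}{\sqrt{n}}g(\log n)+\log(8\pi e^\gamma)-\int_0^\infty\frac{1-g(x)}{2\sinh(x/2)}\,dx+\chi_\Delta(-1)\int_0^\infty\frac{g(x)}{2\cosh(x/2)}\,dx,$$ where $l(g)$ is interpreted as $-\infty$ if the integral $\int_0^\infty\frac{1-g(x)}{2\sinh(x/2)}\,dx$ diverges. Then there exists $g_X\in\mathcal{C}(X)$ such that $l(g_X)\ge l(g)$ for all $g\in\mathcal{C}(X)$.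
   Context: A fundamental discriminant is $1$ or the discriminant of a quadratic number field. For a fundamental discriminant $\Delta$, $\chi_\Delta(n)=\left(\frac{\Delta}{n}\right)$ is the Kronecker symbol. $\Lambda$ is the von Mangoldt function and $\gamma$ is Euler's constant. (For $g\in\mathcal{C}(X)$ the integrand $\frac{1-g(x)}{2\sinh(x/2)}$ is non-negative, so the integral is either finite or $+\infty$.) *)

(* Defs.v *)
From mathcomp Require Import all_boot all_order all_algebra.
From mathcomp Require Import all_classical all_reals all_analysis.
Set Implicit Arguments. Unset Strict Implicit. Unset Printing Implicit Defensive.
Import Order.TTheory GRing.Theory Num.Theory numFieldNormedType.Exports.
Local Open Scope ring_scope.
Local Open Scope classical_set_scope.

Definition sqfreez (m : int) : bool :=
  (m != 0) && [forall p : 'I_(`|m|%N).+1, prime p ==> ~~ ((p * p)%N %| `|m|%N)%N].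

Definition fundamental_discriminant (D : int) : Prop :=
  D = 1 \/
  ((D %% 4)%Z = 1 /\ sqfreez D) \/
  (exists m : int, D = 4 * m /\ ((m %% 4)%Z = 2 \/ (m %% 4)%Z = 3) /\ sqfreez m).

Definition kronecker_prime (a : int) (p : nat) : int :=
  if p == 2%N then
    (if (a %% 2)%Z == 0 then 0
     else if ((a %% 8)%Z == 1) || ((a %% 8)%Z == 7) then 1 else -1)
  else
    let r := (((a %% p%:Z)%Z ^+ (p.-1 %/ 2)) %% p%:Z)%Z in
    if r == 0 then 0 else if r == 1 then 1 else -1.

Definition kronecker (a : int) (n : nat) : int :=
  \prod_(p <- primes n) kronecker_prime a p ^+ logn p n.

Definition kronecker_m1 (a : int) : int := if a < 0 then -1 else 1.

Section RealDefs.
Variable R : realType.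

Definition vonMangoldt (n : nat) : R :=
  if (1 < n)%N && (size (primes n) == 1%N) then ln ((pdiv n)%:R) else 0.

Definition euler_gamma : R :=
  limn (fun N : nat => \sum_(1 <= k < N.+1) (k%:R)^-1 - ln (N.+1)%:R).

Definition sinhR (x : R) : R := (expR x - expR (- x)) / 2.
Definition coshR (x : R) : R := (expR x + expR (- x)) / 2.

Definition cos_transform (g : R -> R) (t : R) : \bar R :=
  (2%:E * \int[@lebesgue_measure R]_(x in `[0%R, +oo[%classic) (g x * cos (t * x))%:E)%E.

(* the class C(X) ; g is a function on R of which only [0,oo) matters *)
Definition classC (X : R) (g : R -> R) : Prop :=
  {within `[0%R, +oo[%classic, continuous g} /\
  (forall x, 0 <= x -> X < x -> g x = 0) /\
  g 0 = 1 /\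
  (forall t : R, (0 <= cos_transform g t)%E).

(* the functional l(g), with value -oo when the sinh integral diverges *)
Definition lfun (D : int) (g : R -> R) : \bar R :=
  ((2 * limn (fun N : nat => \sum_(1 <= n < N)
        vonMangoldt n * (kronecker D n)%:~R / Num.sqrt (n%:R) * g (ln (n%:R)))
     + ln (8 * pi * expR euler_gamma))%:E
   - \int[@lebesgue_measure R]_(x in `[0%R, +oo[%classic) ((1 - g x) / (2 * sinhR (x / 2)))%:E
   + (kronecker_m1 D)%:~R%:E *
       \int[@lebesgue_measure R]_(x in `[0%R, +oo[%classic) (g x / (2 * coshR (x / 2)))%:E)%E.

End RealDefs.

(* Main.v *)
Require Import Defs.
From mathcomp Require Import all_boot all_order all_algebra.
From mathcomp Require Import all_classical all_reals all_analysis.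
From mathcomp Require Import measurable_realfun ring lra.
Set Implicit Arguments. Unset Strict Implicit. Unset Printing Implicit Defensive.
Import Order.TTheory GRing.Theory Num.Theory numFieldNormedType.Exports.
Local Open Scope ring_scope.
Local Open Scope classical_set_scope.

(** Extend [g] to an even function [G]. Testing [G] against the nonnegative
    trigonometric kernels [((1 + cos (al z)) / 2) ^ N], which concentrate at [0]
    and are nonnegative combinations of cosines, shows that every inequality
    [0 <= \sum_i a_i cos (t x_i)] valid for all [t] yields
    [0 <= \sum_i a_i G x_i]. Hence [|G| <= 1],
    [1 - G a <= 2 (1 - G y) + 2 (1 - G (y + a))], and
    [|G x - G y| <= eta + (1 - G (x - y)) / (2 eta)].

    Integrating the second inequality against [dy / y] shows that a bound on the
    hyperbolic sine integral forces [1 - G a = O(1 / log (1 / a))], so, by the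
    third one, a maximizing sequence is uniformly equicontinuous. It has a
    uniform limit point in the class; there the remaining terms of [l] converge,
    and Fatou's lemma handles the hyperbolic sine integral. *)

(** * Integrals of continuous functions over compact intervals *)

Section integrals_of_continuous_functions.
Variable R : realType.
Local Notation mu := (@lebesgue_measure R).
Implicit Types (f g : R -> R) (a b c : R).

Lemma continuous_integrable_itv a b f : continuous f ->
  mu.-integrable `[a, b] (EFin \o f).
Proof.
move=> cf; apply: continuous_compact_integrable; first exact: segment_compact.
exact: continuous_subspaceT.
Qed.

Lemma Rintegral_EFin_itv a b f : continuous f ->
  (\int[mu]_(x in `[a, b]) (f x)%:E)%E = (\int[mu]_(x in `[a, b]) f x)%:E.
Proof.
move=> cf; rewrite /Rintegral fineK//.
exact: (integrable_fin_num _ (continuous_integrable_itv a b cf)).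
Qed.

Lemma Rintegral_itv_cat a c b f : continuous f -> a <= c -> c <= b ->
  \int[mu]_(x in `[a, b]) f x =
  \int[mu]_(x in `[a, c]) f x + \int[mu]_(x in `[c, b]) f x.
Proof.
move=> cf ac cb; apply/eqP; rewrite addrC -subr_eq; apply/eqP.
rewrite Rintegral_itvB ?bnd_simp//; last exact: continuous_integrable_itv.
rewrite Rintegral_itv_obnd_cbnd//.
by apply: integrableS (continuous_integrable_itv c b cf) => //; exact: subset_itv_oc_cc.
Qed.

Lemma Rintegral_itv_cst a b c : a <= b -> \int[mu]_(x in `[a, b]) c = c * (b - a).
Proof.
move=> ab; rewrite Rintegral_cst//= lebesgue_measure_itv/= lte_fin.
case: ltP => // ba; have -> : a = b by apply/eqP; rewrite eq_le ab ba.
by rewrite subrr.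
Qed.

Lemma Rintegral_itv_le_cst a b c f : continuous f -> a <= b ->
  (forall x, a <= x <= b -> f x <= c) -> \int[mu]_(x in `[a, b]) f x <= c * (b - a).
Proof.
move=> cf ab fc; rewrite -Rintegral_itv_cst//; apply: le_Rintegral => //.
- exact: continuous_integrable_itv.
- by apply: continuous_integrable_itv => x; exact: cst_continuous.
Qed.

Lemma Rintegral_itv_eq0 a b f : (forall x, a <= x <= b -> f x = 0) ->
  \int[mu]_(x in `[a, b]) f x = 0.
Proof.
move=> f0; rewrite (eq_Rintegral _ (g := cst 0)).
  by rewrite Rintegral_cst// mul0r.
by move=> x; rewrite inE/= in_itv/= => /f0.
Qed.

Lemma Rintegral_itv_shift a b c f : continuous f -> a <= b ->
  \int[mu]_(x in `[a, b]) f (x + c) = \int[mu]_(x in `[a + c, b + c]) f x.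
Proof.
move=> cf ab; rewrite /Rintegral; congr fine.
have dF x : is_derive x (1 : R) (fun y : R => y + c) 1.
  by apply: is_derive_eq; rewrite addr0.
have dE : (fun y : R => y + c)^`() = cst 1.
  by apply/funext => x; rewrite derive1E; apply: (@derive_val _ _ _ _ _ _ _ (dF x)).
rewrite (@integration_by_substitution_increasing _ (fun y : R => y + c)) ?dE//.
- by apply: eq_integral => x _ /=; rewrite mulr1.
- by move=> x y _ _; rewrite ltrD2r.
- by move=> x _; exact: cst_continuous.
- exact: is_cvg_cst.
- exact: is_cvg_cst.
- have cF : continuous (fun y : R => y + c).
    by move=> x; apply: differentiable_continuous; exact/derivable1_diffP.
  by split => //; [exact: cvg_at_right_filter (cF a) | exact: cvg_at_left_filter (cF b)].
- exact: continuous_subspaceT.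
Qed.

Lemma Rintegral_itv_opp a b f : continuous f -> a <= b ->
  \int[mu]_(x in `[a, b]) f (- x) = \int[mu]_(x in `[- b, - a]) f x.
Proof.
move=> cf ab; rewrite /Rintegral integration_by_substitution_oppr//.
exact: continuous_subspaceT.
Qed.

Lemma Rintegral_itv_sum (I : Type) (s : seq I) (F : I -> R -> R) a b :
  (forall i, continuous (F i)) ->
  \int[mu]_(x in `[a, b]) (\sum_(i <- s) F i x) =
  \sum_(i <- s) \int[mu]_(x in `[a, b]) F i x.
Proof.
move=> cF; elim: s => [|i s IH].
  by rewrite big_nil Rintegral_itv_eq0// => x _; rewrite big_nil.
rewrite big_cons -IH -RintegralD//.
- by apply: eq_Rintegral => x _; rewrite big_cons.
- exact: continuous_integrable_itv.
- apply: continuous_integrable_itv => x.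
  have -> : (fun y => \sum_(j <- s) F j y) = \sum_(j <- s) F j.
    by apply/funext => y; rewrite fct_sumE.
  elim/big_ind: _ => [|u v cu cv|j _]; [exact: cst_continuous|exact: continuousD|exact: cF].
Qed.

End integrals_of_continuous_functions.

(** * Positivity of cosine sums, tested with concentrating kernels *)

Section cosine_positivity.
Variable R : realType.
Local Notation mu := (@lebesgue_measure R).
Implicit Types (s : seq (R * R)) (G : R -> R) (X x B al : R).

Definition cos_kernel (al : R) (N : nat) (z : R) : R := ((1 + cos (al * z)) / 2) ^+ N.

Lemma continuous_cosZ (t : R) : continuous (fun z => cos (t * z)).
Proof.
move=> z; apply: continuous_comp; last exact: continuous_cos.
by apply: continuousM; [exact: cst_continuous|exact: cvg_id].
Qed.

Lemma cos_kernel_continuous al N : continuous (cos_kernel al N).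
Proof.
move=> z; apply: (continuous_comp (f := fun z => (1 + cos (al * z)) / 2) (g := fun u : R => u ^+ N)); last exact: exprn_continuous.
apply: continuousM; last exact: cst_continuous.
by apply: continuousD; [exact: cst_continuous|exact: continuous_cosZ].
Qed.

Lemma cos_kernel_ge0 al N z : 0 <= cos_kernel al N z.
Proof. by apply: exprn_ge0; have := cos_geN1 (al * z); lra. Qed.

Lemma cos_kernelN al N z : cos_kernel al N (- z) = cos_kernel al N z.
Proof. by rewrite /cos_kernel mulrN cosN. Qed.

Lemma cos_kernel_norm al N z : cos_kernel al N `|z| = cos_kernel al N z.
Proof. by case: (ger0P z) => _; rewrite ?cos_kernelN. Qed.

(** The bound on [al * |y|] keeps both arguments in [[0, pi]], where the cosine decreases. *)
Lemma cos_kernel_le al N x y : 0 < al -> 0 <= x -> x <= `|y| -> al * `|y| <= 1 ->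
  cos_kernel al N y <= cos_kernel al N x.
Proof.
move=> al0 x0 xy y1; rewrite -(cos_kernel_norm _ _ y).
have pi2 := pi_ge2 R.
apply: lerXn2r; rewrite ?nnegrE.
- by have := cos_geN1 (al * `|y|); lra.
- by have := cos_geN1 (al * x); lra.
have yx : al * x <= al * `|y| by rewrite ler_pM2l.
have : cos (al * `|y|) <= cos (al * x).
  have x0' : 0 <= al * x by apply: mulr_ge0 => //; exact: ltW.
  by rewrite leNgt ltr_cos ?in_itv//= -?leNgt//; lra.
lra.
Qed.

(** One more factor [(1 + cos (al z)) / 2] splits a term of frequency [b] into terms of frequencies
    [b], [b + al] and [b - al] with weights 1/2, 1/4 and 1/4, so the coefficients stay
    nonnegative. *)
Lemma cos_kernel_expansion al N : exists s, (forall p, p \in s -> 0 <= p.1) /\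
  cos_kernel al N =1 fun z => \sum_(p <- s) p.1 * cos (p.2 * z).
Proof.
elim: N => [|N [s [s0 sE]]].
  exists [:: (1, 0)]; split=> [p|z]; first by rewrite inE => /eqP ->.
  by rewrite big_seq1/= mul0r cos0 mulr1 /cos_kernel expr0.
exists ([seq (p.1 / 2, p.2) | p <- s] ++
  [seq (p.1 / 4, p.2 + al) | p <- s] ++ [seq (p.1 / 4, p.2 - al) | p <- s]); split.
  by move=> p; rewrite !mem_cat => /or3P[] /mapP[q /s0 q0 ->]/=; apply: divr_ge0.
move=> z; rewrite /cos_kernel exprS -/(cos_kernel al N z) sE !big_cat !big_map/=.
rewrite -!big_split/= mulr_sumr; apply: eq_bigr => p _.
by rewrite (mulrDl p.2 al) (mulrDl p.2 (- al)) mulNr !cosD cosN sinN; field.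
Qed.

(* Expanding the kernel, the integral is a nonnegative combination of the
   products of [\sum_i a_i cos (t x_i)] and the cosine transform of [G] at [t]. *)
Lemma smoothed_positivity G X s al N : continuous G ->
  (forall t, 0 <= \int[mu]_(y in `[0, X]) (G y * cos (t * y))) ->
  (forall t, 0 <= \sum_(p <- s) p.1 * cos (t * p.2)) ->
  0 <= \sum_(p <- s) p.1 * \int[mu]_(y in `[0, X])
         (G y * (cos_kernel al N (y - p.2) + cos_kernel al N (y + p.2))).
Proof.
move=> cG hG hs; have [w [w0 wE]] := cos_kernel_expansion al N.
have cGc t : continuous (fun y => G y * cos (t * y)).
  by move=> y; apply: continuousM; [exact: cG|exact: continuous_cosZ].
suff -> : \sum_(p <- s) p.1 * \int[mu]_(y in `[0, X])
         (G y * (cos_kernel al N (y - p.2) + cos_kernel al N (y + p.2))) =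
   \sum_(q <- w) 2 * q.1 * (\sum_(p <- s) p.1 * cos (q.2 * p.2)) *
     \int[mu]_(y in `[0, X]) (G y * cos (q.2 * y)).
  rewrite big_seq; apply: sumr_ge0 => q qw.
  by rewrite mulr_ge0// mulr_ge0// mulr_ge0// w0.
transitivity (\sum_(p <- s) p.1 * \sum_(q <- w) 2 * q.1 * cos (q.2 * p.2) *
     \int[mu]_(y in `[0, X]) (G y * cos (q.2 * y))).
  apply: eq_bigr => p _; congr (_ * _).
  (* The kernel is symmetrized so that, at each frequency [q], the two shifted cosines combine into
     the product [2 cos (q x) cos (q y)], where [x] is the node. *)
  transitivity (\int[mu]_(y in `[0, X])
     (\sum_(q <- w) 2 * q.1 * cos (q.2 * p.2) * (G y * cos (q.2 * y)))).
    apply: eq_Rintegral => y _; rewrite !wE -big_split/= mulr_sumr.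
    by apply: eq_bigr => q _; rewrite !(mulrDr q.2) mulrN !cosD cosN sinN; ring.
  rewrite Rintegral_itv_sum; last first.
    by move=> q y; apply: cvgM; [exact: cvg_cst|exact: cGc].
  by apply: eq_bigr => q _; rewrite RintegralZl//; exact: continuous_integrable_itv.
rewrite (eq_bigr _ (fun p _ => mulr_sumr _ _ _ _)) exchange_big/=.
apply: eq_bigr => q _; rewrite mulr_sumr mulr_suml; apply: eq_bigr => p _.
by ring.
Qed.

(** Evenness folds the two terms into one integral over [[-X, X]]. Translation by [x] turns the
    range into [[-X - x, X - x]], which lies in [[-B, B]] and outside of which [G (z + x)] vanishes.
    A large [B] thus serves several shifts [x] at once. *)
Lemma Rintegral_even_shift G K X x B : continuous G -> continuous K ->
  (forall y, G (- y) = G y) -> (forall y, K (- y) = K y) ->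
  0 <= X -> (forall y, X <= `|y| -> G y = 0) -> X + `|x| <= B ->
  \int[mu]_(y in `[0, X]) (G y * (K (y - x) + K (y + x))) =
  \int[mu]_(z in `[- B, B]) (G (z + x) * K z).
Proof.
move=> cG cK eG eK X0 sG xB.
have cs (f : R -> R) c : continuous f -> continuous (fun y => f (y + c)).
  move=> cf y; apply: (continuous_comp (f := fun y => y + c)); last exact: cf.
  by apply: continuousD; [exact: cvg_id|exact: cst_continuous].
pose f z := G (z + x) * K z.
have cf : continuous f by move=> z; apply: continuousM; [exact: cs|exact: cK].
have -> : \int[mu]_(y in `[0, X]) (G y * (K (y - x) + K (y + x))) =
   \int[mu]_(y in `[0, X]) (f (y - x)) + \int[mu]_(y in `[0, X]) (f (- y - x)).
  rewrite -RintegralD//; last 2 first.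
  - by apply: continuous_integrable_itv; exact: cs.
  - apply: continuous_integrable_itv => y.
    apply: (continuous_comp (f := -%R) (g := fun y => f (y - x))); last exact: cs.
    exact: opp_continuous.
  apply: eq_Rintegral => y _; rewrite /f !subrK eG -opprD eK; ring.
rewrite Rintegral_itv_shift// (@Rintegral_itv_opp _ 0 X (fun y => f (y - x)))//; last exact: cs.
rewrite Rintegral_itv_shift//; last by lra.
have := ler_norm x; have := ler_norm (- x); rewrite normrN => x1 x2.
rewrite (@Rintegral_itv_cat _ (- B) (- X - x) B)//; try lra.
rewrite (@Rintegral_itv_cat _ (- X - x) (- x) B)//; try lra.
rewrite (@Rintegral_itv_cat _ (- x) (X - x) B)//; try lra.
rewrite oppr0 !sub0r (@Rintegral_itv_eq0 _ (- B)) ?(@Rintegral_itv_eq0 _ _ B).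
- by rewrite /f; ring.
- move=> z /andP[z1 z2]; rewrite sG ?mul0r//.
  by apply: le_trans (ler_norm _); lra.
- move=> z /andP[z1 z2]; rewrite sG ?mul0r//.
  by rewrite -normrN; apply: le_trans (ler_norm _); lra.
Qed.

(** [F] is at most [F 0 / 2 < 0] for [|z| <= d]. With [k] the base of the kernel, the part
    [|z| <= d / 2] contributes a negative amount of order [k (d / 2) ^ N], and the rest at most a
    multiple of [k d ^ N], which is exponentially smaller. *)
Lemma cos_kernel_concentration (F : R -> R) (B al : R) : continuous F -> F 0 < 0 ->
  0 < B -> 0 < al -> al * B <= 1 ->
  exists N, \int[mu]_(z in `[- B, B]) (F z * cos_kernel al N z) < 0.
Proof.
move=> cF F0 B0 al0 alB.
have [d [d0 dB Fd]] : exists d : R, [/\ 0 < d, d <= B & forall z, `|z| <= d -> F z <= F 0 / 2].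
  have e0 : 0 < - F 0 / 2 by lra.
  have /cvgrPdist_lt/(_ _ e0)/nbhs_ballP[d /= d0 dF] := cF 0.
  exists (Num.min (d / 2) B); split; rewrite ?lt_min ?B0 ?divr_gt0//.
    by rewrite ge_min lexx orbT.
  move=> z; rewrite le_min => /andP[zd _].
  have : ball 0 d z by rewrite /ball/= sub0r normrN; lra.
  move=> /dF/= /ltr_normlP[]; lra.
have [M [M0 FM]] : exists M : R, 0 <= M /\ forall z, - B <= z <= B -> F z <= M.
  have [|c _ cM] := @EVT_max _ F (- B) B _ (continuous_subspaceT cF); first by lra.
  exists `|F c|; split=> // z zB; apply: le_trans (ler_norm _).
  by apply: cM; rewrite in_itv.
pose k z := (1 + cos (al * z)) / 2.
have kE N z : cos_kernel al N z = k z ^+ N by [].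
have kd0 : 0 <= k d by have := cos_kernel_ge0 al 1 d; rewrite kE expr1.
have kd : k d < k (d / 2).
  rewrite /k; suff : cos (al * d) < cos (al * (d / 2)) by lra.
  have dd : al * (d / 2) < al * d by rewrite ltr_pM2l//; lra.
  have d20 : 0 <= al * (d / 2) by rewrite mulr_ge0//; lra.
  have db : al * d <= al * B by rewrite ler_pM2l.
  by have pi2 := pi_ge2 R; rewrite ltr_cos ?in_itv//=; lra.
have kp : 0 < k (d / 2) by exact: le_lt_trans kd.
(* The ratio [k d / k (d / 2)] is below 1, so its powers tend to 0. The [+ 1] in the threshold
   guards against [B * M = 0]. *)
have [N NM] : exists N, 2 * B * M * k d ^+ N < (- F 0 / 2) * d * k (d / 2) ^+ N.
  have q1 : `|k d / k (d / 2)| < 1.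
    by rewrite ger0_norm ?divr_ge0 ?(ltW kp)// ltr_pdivrMr// mul1r.
  have e0 : 0 < (- F 0 / 2) * d / (2 * B * M + 1).
    have BM : 0 <= B * M by rewrite mulr_ge0// ltW.
    by rewrite divr_gt0 ?mulr_gt0 ?divr_gt0//; lra.
  have /cvgrPdist_lt/(_ _ e0) := cvg_expr q1.
  case=> N _ /(_ N (leqnn N))/=; rewrite sub0r normrN => lt.
  have {}lt := le_lt_trans (ler_norm _) lt.
  exists N; move: lt; rewrite expr_div_n ltr_pdivrMr ?exprn_gt0//.
  have BM : 0 <= B * M by rewrite mulr_ge0// ltW.
  rewrite mulrAC ltr_pdivlMr; last by lra.
  apply: le_lt_trans; rewrite [leRHS]mulrC ler_wpM2r ?exprn_ge0//; lra.
exists N.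
have cFK : continuous (fun z => F z * cos_kernel al N z).
  by move=> z; apply: continuousM; [exact: cF|exact: cos_kernel_continuous].
(* Between [d / 2] and [d] the kernel may exceed [k d ^ N], but there [F] is negative and the
   product is at most 0. *)
have far z : d / 2 <= `|z| -> `|z| <= B -> F z * cos_kernel al N z <= M * k d ^+ N.
  move=> z1 z2; have [zd|zd] := leP `|z| d.
    apply: (@le_trans _ _ 0); last by rewrite mulr_ge0// exprn_ge0.
    rewrite mulr_le0_ge0 ?cos_kernel_ge0//; apply: le_trans (Fd _ zd) _; lra.
  apply: (@le_trans _ _ (M * cos_kernel al N z)).
    by rewrite ler_wpM2r ?cos_kernel_ge0// FM// -ler_norml.
  rewrite ler_wpM2l//; apply: cos_kernel_le => //; [exact: ltW|exact: ltW|].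
  by apply: le_trans alB; rewrite ler_pM2l.
have near z : `|z| <= d / 2 ->
    F z * cos_kernel al N z <= (F 0 / 2) * k (d / 2) ^+ N.
  move=> z1; have zF : F z <= F 0 / 2 by apply: Fd; lra.
  apply: (@le_trans _ _ (F 0 / 2 * cos_kernel al N z)).
    by rewrite ler_wpM2r ?cos_kernel_ge0.
  rewrite ler_wnM2l//; first by lra.
  rewrite -kE -[leRHS]cos_kernel_norm; apply: cos_kernel_le => //.
  - by rewrite (@ger0_norm _ (d / 2))//; lra.
  - by apply: le_trans alB; rewrite ler_pM2l// ger0_norm; lra.
rewrite (@Rintegral_itv_cat _ (- B) (- (d / 2)) B)//; try lra.
rewrite (@Rintegral_itv_cat _ (- (d / 2)) (d / 2) B)//; try lra.
have I1 : \int[mu]_(z in `[- B, - (d / 2)]) (F z * cos_kernel al N z) <=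
    M * k d ^+ N * (- (d / 2) - - B).
  apply: Rintegral_itv_le_cst => //; first by lra.
  by move=> z /andP[z1 z2]; apply: far; rewrite ler0_norm; lra.
have I2 : \int[mu]_(z in `[- (d / 2), d / 2]) (F z * cos_kernel al N z) <=
    F 0 / 2 * k (d / 2) ^+ N * (d / 2 - - (d / 2)).
  apply: Rintegral_itv_le_cst => //; first by lra.
  by move=> z zd; apply: near; rewrite ler_norml.
have I3 : \int[mu]_(z in `[d / 2, B]) (F z * cos_kernel al N z) <=
    M * k d ^+ N * (B - d / 2).
  apply: Rintegral_itv_le_cst => //; first by lra.
  by move=> z /andP[z1 z2]; apply: far; rewrite ger0_norm; lra.
have Mk : 0 <= M * k d ^+ N * d by rewrite !mulr_ge0// ?exprn_ge0// ltW.
apply: (@le_lt_trans _ _ (2 * B * M * k d ^+ N - M * k d ^+ N * d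
   - ((- F 0 / 2) * d * k (d / 2) ^+ N))); last by lra.
apply: le_trans (lerD I1 (lerD I2 I3)) _.
by rewrite le_eqVlt; apply/orP; left; apply/eqP; field.
Qed.

(* Bochner's positivity for the (unknown) representing measure of [G], tested
   on even trigonometric sums. *)
Lemma cos_positivity G X s : continuous G -> (forall y, G (- y) = G y) ->
  0 <= X -> (forall y, X <= `|y| -> G y = 0) ->
  (forall t, 0 <= \int[mu]_(y in `[0, X]) (G y * cos (t * y))) ->
  (forall t, 0 <= \sum_(p <- s) p.1 * cos (t * p.2)) ->
  0 <= \sum_(p <- s) p.1 * G p.2.
Proof.
move=> cG eG X0 sG hG hs; rewrite leNgt; apply/negP => F0.
(* [B] is at least [X + |x|] for every node [x], so all the shifted integrals share the range
   [[-B, B]]. The [+ 1] makes it positive, so that [B^-1] can be the frequency of the kernel. *)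
pose B := X + \sum_(p <- s) `|p.2| + 1.
have S0 : 0 <= \sum_(p <- s) `|p.2| by exact: sumr_ge0.
have B0 : 0 < B by rewrite /B; lra.
have cs c : continuous (fun z => G (z + c)).
  move=> y; apply: (continuous_comp (f := fun y => y + c)); last exact: cG.
  by apply: continuousD; [exact: cvg_id|exact: cst_continuous].
have cZ (p : R * R) : continuous (fun z => p.1 * G (z + p.2)).
  by move=> z; apply: cvgM; [exact: cvg_cst|exact: cs].
have cF : continuous (fun z => \sum_(p <- s) p.1 * G (z + p.2)).
  have -> : (fun z => \sum_(p <- s) p.1 * G (z + p.2)) =
     \sum_(p <- s) (fun z => p.1 * G (z + p.2)).
    by apply/funext => y; rewrite fct_sumE.
  move=> z; elim/big_ind: _ => [|u v cu cv|j _].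
  - exact: cst_continuous.
  - exact: continuousD.
  - exact: cZ.
have [] := @cos_kernel_concentration _ B B^-1 cF _ B0.
- by under eq_bigr do rewrite add0r.
- by rewrite invr_gt0.
- by rewrite mulVf ?gt_eqF.
move=> N; apply/negP; rewrite -leNgt.
have cGK c : continuous (fun z => G (z + c) * cos_kernel B^-1 N z).
  by move=> z; apply: continuousM; [exact: cs|exact: cos_kernel_continuous].
have := smoothed_positivity B^-1 N cG hG hs; congr (_ <= _).
transitivity (\int[mu]_(z in `[- B, B])
    (\sum_(p <- s) p.1 * (G (z + p.2) * cos_kernel B^-1 N z))); last first.
  by apply: eq_Rintegral => z _; rewrite mulr_suml; apply: eq_bigr => p _; ring.
rewrite Rintegral_itv_sum; last first.
  by move=> p z; apply: cvgM; [exact: cvg_cst|exact: cGK].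
apply: eq_big_seq => p ps.
rewrite RintegralZl//; last exact: continuous_integrable_itv.
congr (_ * _); apply: Rintegral_even_shift => //.
- exact: cos_kernel_continuous.
- exact: cos_kernelN.
- rewrite /B (perm_big _ (perm_to_rem ps)) big_cons/=.
  have : 0 <= \sum_(q <- rem p s) `|q.2| by exact: sumr_ge0.
  lra.
Qed.

End cosine_positivity.

(** * The class of even extensions and its elementary properties *)

Section even_class.
Variable R : realType.
Local Notation mu := (@lebesgue_measure R).
Implicit Types (G : R -> R) (X C a x y eps eta : R).

(** Working on the whole line makes sense of [G (y + a)] and [G (x - y)] for all arguments.
    Vanishing is required at [|y| = X] too, and the transform is a real integral over the support,
    without its factor 2. *)
Definition even_class X G := [/\ continuous G, forall y, G (- y) = G y,
  forall y, X <= `|y| -> G y = 0, G 0 = 1 &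
  forall t, 0 <= \int[mu]_(y in `[0, X]) (G y * cos (t * y))].

Lemma integral_bounded_support X (f : R -> R) : (forall y, X <= y -> f y = 0) ->
  (\int[mu]_(x in `[0%R, +oo[) (f x)%:E = \int[mu]_(x in `[0%R, X]) (f x)%:E)%E.
Proof.
move=> f0; rewrite integral_mkcond [RHS]integral_mkcond; apply: eq_integral => x _.
rewrite !patchE; case: ifPn; case: ifPn => //; rewrite !inE/= !in_itv/=.
- by move=> /negP xX /andP[x0 _]; rewrite f0// leNgt; apply/negP => /ltW ?; apply: xX; rewrite inE/= in_itv/= x0.
- by move=> /andP[x0 _] /negP[]; rewrite inE/= in_itv/= x0.
Qed.

Lemma cos_transformE X G t : continuous G -> (forall y, X <= `|y| -> G y = 0) -> 0 <= X ->
  cos_transform G t = (2 * \int[mu]_(y in `[0, X]) (G y * cos (t * y)))%:E.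
Proof.
move=> cG sG X0; rewrite /cos_transform (@integral_bounded_support X).
  rewrite Rintegral_EFin_itv// => y.
  by apply: continuousM; [exact: cG|exact: continuous_cosZ].
by move=> y Xy; rewrite sG ?mul0r// ger0_norm// (le_trans X0).
Qed.

Lemma even_class_classC X G : 0 <= X -> even_class X G -> classC X G.
Proof.
move=> X0 [cG eG sG G0 hG]; split; first exact: continuous_subspaceT.
split; first by move=> x x0 Xx; rewrite sG// ger0_norm// ltW.
split=> // t; rewrite (@cos_transformE X)// lee_fin mulr_ge0//.
Qed.

Lemma continuous_even_extension (g : R -> R) :
  {within `[0%R, +oo[, continuous g} -> continuous (fun y : R => g `|y|).
Proof.
move=> /subspace_continuousP cg x.
apply: (@cvg_comp _ _ _ (fun y : R => `|y|) g _ (within `[0%R, +oo[ (nbhs `|x|))); last first.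
  by apply: cg; rewrite /= in_itv/= normr_ge0.
move=> P wP; have H : nbhs x (fun y : R => `[0%R, +oo[%classic `|y| -> P `|y|).
  exact: (@norm_continuous _ _ x _ wP).
apply: (@filterS R (nbhs x) _ _ (fun y : R => P `|y|)) H => y; apply.
by rewrite /= in_itv/= normr_ge0.
Qed.

Lemma classC_even_class X (g : R -> R) : 0 < X -> classC X g -> even_class X (fun y => g `|y|).
Proof.
move=> X0 [/continuous_even_extension cg [sg [g0 hg]]].
have sG y : X <= `|y| -> g `|y| = 0.
  rewrite le_eqVlt => /orP[/eqP Xy|Xy]; last exact: sg.
  rewrite /= -Xy.
  (* [classC] forces vanishing only beyond [X]; the value at [X] itself is the limit from the
     right. *)
  have c1 : g `|z| @[z --> X^'+] --> g X.
    have := cvg_at_right_filter (cg X); rewrite /= gtr0_norm//; exact.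
  have c0 : g `|z| @[z --> X^'+] --> (0 : R).
    apply: cvg_near_cst; near=> z; apply: sg => //.
    by apply: lt_le_trans (ler_norm _); near: z; exact: nbhs_right_gt.
  by have := cvg_unique _ c1 c0; exact.
split=> //.
- by move=> y /=; rewrite normrN.
- by rewrite /= normr0.
- move=> t; have := hg t.
  have -> : cos_transform g t = cos_transform (fun y => g `|y|) t.
    rewrite /cos_transform; congr (_ * _)%E; apply: eq_integral => x.
    by rewrite inE/= in_itv/= andbT => x0; rewrite ger0_norm.
  by rewrite (@cos_transformE X)// ?(ltW X0)// lee_fin pmulr_rge0.
Unshelve. all: end_near. Qed.

(** The triangle function [max 0 (1 - |y| / X)] works: for [t != 0] an antiderivative found by parts
    gives the Fejér expression [(1 - cos (t X)) / (t^2 X)]. This provides a maximizer when [l] is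
    [-oo] on the whole class. *)
Lemma even_class_nonempty X : 0 < X -> exists G, even_class X G.
Proof.
move=> X0; pose T (y : R) : R := Num.max 0 (1 - `|y| / X).
have cl (y : R) : {for y, continuous (fun y : R => 1 - y / X)}.
  apply: continuousB; first exact: cst_continuous.
  by apply: continuousM; [exact: cvg_id|exact: cst_continuous].
exists T; split.
- move=> y; apply: (continuous_max (f := cst 0) (g := fun y => 1 - `|y| / X)).
    exact: cst_continuous.
  by apply: (continuous_comp (f := fun y : R => `|y|) (g := fun y : R => 1 - y / X));
    [exact: norm_continuous|exact: cl].
- by move=> y; rewrite /T normrN.
- move=> y Xy; rewrite /T; apply/max_idPl.
  by rewrite subr_le0 ler_pdivlMr// mul1r.
- by rewrite /T normr0 mul0r subr0; apply/max_idPr.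
move=> t.
have TE y : 0 <= y <= X -> T y = 1 - y / X.
  move=> /andP[y0 yX]; rewrite /T ger0_norm//; apply/max_idPr.
  by rewrite subr_ge0 ler_pdivrMr// mul1r.
have [->|t0] := eqVneq t 0.
  by apply: Rintegral_ge0 => y _; rewrite mul0r cos0 mulr1 /T le_max lexx.
pose f (y : R) : R := (1 - y / X) * cos (t * y).
have cf : continuous f by move=> y; apply: cvgM; [exact: cl|exact: continuous_cosZ].
have -> : \int[mu]_(y in `[0, X]) (T y * cos (t * y)) = \int[mu]_(y in `[0, X]) f y.
  by apply: eq_Rintegral => y; rewrite inE/= in_itv/= => /TE ->.
pose F (y : R) : R := (1 - y / X) * sin (t * y) / t - cos (t * y) / (t ^+ 2 * X).
have dl y : is_derive y (1 : R) (fun y : R => 1 - y / X) (- X^-1).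
  by apply: is_derive_eq; rewrite /GRing.scale/=; ring.
have dt y : is_derive y (1 : R) (fun y : R => t * y) t.
  by apply: is_derive_eq; rewrite /GRing.scale/=; ring.
have dF y : is_derive y (1 : R) F (f y).
  have ds := is_derive1_comp (is_derive_sin (t * y)) (dt y).
  have dc := is_derive1_comp (is_derive_cos (t * y)) (dt y).
  have X0' := lt0r_neq0 X0.
  have dd : is_derive y (1 : R) F _ := is_deriveB (is_deriveM (is_deriveM (dl y) ds) (is_derive_cst t^-1 y 1))
    (is_deriveM dc (is_derive_cst (t ^+ 2 * X)^-1 y 1)).
  by apply: (is_derive_eq dd); rewrite /f /GRing.scale/=; field; rewrite X0' t0.
have cF : continuous F.
  by move=> y; apply: differentiable_continuous; apply/derivable1_diffP; have [] := dF y.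
rewrite /Rintegral (@continuous_FTC2 _ _ F) //=.
- rewrite /F divff ?gt_eqF// subrr !mul0r mulr0 cos0 sin0 !sub0r mulr0 mul0r sub0r opprK.
  by rewrite addrC -mulrBl divr_ge0 ?subr_ge0 ?cos_le1// mulr_ge0 ?sqr_ge0// ltW.
- exact: continuous_subspaceT.
- split; first by move=> y _; have [] := dF y.
  + by apply: cvg_at_right_filter; exact: cF.
  + by apply: cvg_at_left_filter; exact: cF.
- by move=> y _; rewrite derive1E; apply: derive_val.
Qed.

(** * Pointwise inequalities obtained from cosine positivity *)

Lemma even_class_le1 X G x : 0 <= X -> even_class X G -> G x <= 1.
Proof.
move=> X0 [cG eG sG G0 hG].
have := @cos_positivity _ G X [:: (1, 0); (-1, x)] cG eG X0 sG hG.
rewrite !big_cons !big_nil/= G0 => /(_ _)H; rewrite -subr_ge0.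
have : 0 <= 1 * 1 + (-1 * G x + 0); last by lra.
apply: H => t; rewrite !big_cons !big_nil/= mulr0 cos0.
by have := cos_le1 (t * x); lra.
Qed.

Lemma even_class_geN1 X G x : 0 <= X -> even_class X G -> -1 <= G x.
Proof.
move=> X0 [cG eG sG G0 hG].
have := @cos_positivity _ G X [:: (1, 0); (1, x)] cG eG X0 sG hG.
rewrite !big_cons !big_nil/= G0 => H.
have : 0 <= 1 * 1 + (1 * G x + 0); last by lra.
apply: H => t; rewrite !big_cons !big_nil/= mulr0 cos0.
by have := cos_geN1 (t * x); lra.
Qed.

(* [3 + cos (u - v) - 2 cos u - 2 cos v] is half the squared modulus of
   [exp (i u) + exp (i v) - 2]. *)
Lemma even_class_subadditive X G a y : 0 <= X -> even_class X G ->
  1 - G a <= 2 * (1 - G y) + 2 * (1 - G (y + a)).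
Proof.
move=> X0 [cG eG sG G0 hG].
have := @cos_positivity _ G X [:: (3, 0); (1, a); (- 2, y); (- 2, y + a)] cG eG X0 sG hG.
rewrite !big_cons !big_nil/= G0 => H.
have : 0 <= 3 * 1 + (1 * G a + (- 2 * G y + (- 2 * G (y + a) + 0))); last by lra.
apply: H => t; rewrite !big_cons !big_nil/= mulr0 cos0.
have -> : t * a = t * (y + a) - t * y by ring.
rewrite cosB; set u := t * y; set v := t * (y + a).
have := cos2Dsin2 u; have := cos2Dsin2 v.
have := sqr_ge0 (cos u + cos v - 2); have := sqr_ge0 (sin u + sin v).
by rewrite !expr2; nra.
Qed.

(* Linearised form of Krein's inequality [(G x - G y)^2 <= 2 (1 - G (x - y))]. *)
Lemma even_class_krein X G x y eta : 0 <= X -> even_class X G -> 0 < eta ->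
  2 * eta * (G x - G y) <= 2 * eta ^+ 2 + (1 - G (x - y)).
Proof.
move=> X0 [cG eG sG G0 hG] eta0.
have := @cos_positivity _ G X
  [:: (2 * eta ^+ 2 + 1, 0); (-1, x - y); (- (2 * eta), x); (2 * eta, y)] cG eG X0 sG hG.
rewrite !big_cons !big_nil/= G0 => H.
have : 0 <= (2 * eta ^+ 2 + 1) * 1 +
  (-1 * G (x - y) + (- (2 * eta) * G x + (2 * eta * G y + 0))); last by lra.
apply: H => t; rewrite !big_cons !big_nil/= mulr0 cos0 mulrBr cosB.
(* The trigonometric sum is half the squared modulus of [2 eta - (exp (i u) - exp (i v))]. *)
set u := t * x; set v := t * y.
have := cos2Dsin2 u; have := cos2Dsin2 v.
have := sqr_ge0 (2 * eta - (cos u - cos v)); have := sqr_ge0 (sin u - sin v).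
by rewrite !expr2; nra.
Qed.

(** * The hyperbolic sine integral and the equicontinuity it forces *)

Lemma sinhR_gt0 (x : R) : 0 < x -> 0 < sinhR x.
Proof.
by move=> x0; rewrite /sinhR divr_gt0// subr_gt0 ltr_expR; lra.
Qed.

(** Here [2 sinh (x / 2) = exp (x / 2) (1 - exp (- x))], with factors at most [e] and [x]. Near 0
    this trades the hyperbolic weight for [1 / x]. *)
Lemma sinhR_half_le (x : R) : 0 <= x <= 1 -> 2 * sinhR (x / 2) <= expR 1 * x.
Proof.
move=> /andP[x0 x1]; rewrite /sinhR.
have -> : 2 * ((expR (x / 2) - expR (- (x / 2))) / 2) = expR (x / 2) - expR (- (x / 2)) by field.
have h1 : 1 + - x <= expR (- x) by exact: expR_ge1Dx.
have h2 : expR (- (x / 2)) = expR (x / 2) * expR (- x).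
  by rewrite -expRD; congr expR; field.
have h3 : expR (x / 2) <= expR 1 by rewrite ler_expR; lra.
have h4 := expR_gt0 (x / 2).
rewrite h2; apply: (@le_trans _ _ (expR (x / 2) * x)); last by rewrite ler_wpM2r.
by rewrite -[X in X - _]mulr1 -mulrBr ler_wpM2l ?(ltW h4)//; lra.
Qed.

Definition sinh_integrand G (x : R) : R := (1 - G x) / (2 * sinhR (x / 2)).

Lemma sinh_integrand_ge0 X G x : 0 <= X -> even_class X G -> 0 <= x ->
  0 <= sinh_integrand G x.
Proof.
move=> X0 eG; rewrite le_eqVlt => /orP[/eqP <-|x0].
  by rewrite /sinh_integrand; case: eG => _ _ _ -> _; rewrite subrr mul0r.
rewrite divr_ge0// ?subr_ge0 ?(even_class_le1 _ X0 eG)// mulr_ge0//.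
by apply/ltW/sinhR_gt0; lra.
Qed.

Lemma measurable_sinh_integrand G : continuous G ->
  measurable_fun (`[0%R, +oo[ : set R) (sinh_integrand G).
Proof.
move=> cG.
(* The point 0, where the denominator vanishes, is split off; on the open half-line the integrand is
   continuous. *)
rewrite -(@setU1itv _ _ +oo%O (0 : R) false)// measurable_funU//; split.
  exact: measurable_fun_set1.
apply: open_continuous_measurable_fun => //.
move=> x; rewrite inE/= in_itv/= andbT => x0.
have ch : continuous (fun y : R => y / 2).
  by move=> y; apply: cvgM; [exact: cvg_id|exact: cvg_cst].
have ce : continuous (fun y : R => expR (y / 2)).
  by move=> y; apply: continuous_comp; [exact: ch|exact: continuous_expR].
have cn : continuous (fun y : R => expR (- (y / 2))).
  by move=> y; apply: continuous_comp; [apply: cvgN; exact: ch|exact: continuous_expR].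
apply: cvgM; first by apply: cvgB; [exact: cvg_cst|exact: cG].
apply: cvgV; first by rewrite mulf_neq0// gt_eqF// sinhR_gt0// divr_gt0.
apply: cvgM; first exact: cvg_cst.
apply: cvgM; last exact: cvg_cst.
by apply: cvgB; [exact: ce|exact: cn].
Qed.

(** The absolute value makes the regularized weight continuous on the whole line, as the integral
    lemmas above require. *)
Lemma continuous_inv_normD (b : R) : 0 < b -> continuous (fun y : R => (`|y| + b)^-1).
Proof.
move=> b0 y; apply: cvgV; first by rewrite gt_eqF// ltr_wpDl.
by apply: cvgD; [exact: norm_continuous|exact: cvg_cst].
Qed.

Lemma Rintegral_inv_shift (a : R) : 0 < a < 1 ->
  \int[mu]_(y in `[0, 1 - a]) (`|y| + 2 * a)^-1 = ln (1 + a) - ln (2 * a).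
Proof.
move=> /andP[a0 a1]; pose F (y : R) := ln (y + 2 * a).
have dF (y : R) : 0 <= y -> is_derive y (1 : R) F (y + 2 * a)^-1.
  move=> y0; have ya : 0 < y + 2 * a by lra.
  have dl := is_derive1_ln ya.
  have ds : is_derive y (1 : R) (fun y : R => y + 2 * a) 1.
    by apply: is_derive_eq; rewrite addr0.
  have := @is_derive1_comp _ (@ln R) (fun y : R => y + 2 * a) y _ _ dl ds.
  by rewrite mulr1.
have cFF (y : R) : 0 <= y -> {for y, continuous F}.
  move=> y0; apply: differentiable_continuous; apply/derivable1_diffP.
  by have [] := dF y y0.
rewrite /Rintegral (@continuous_FTC2 _ _ F) //=; first by rewrite /F add0r; congr (ln _ - _); lra.
- lra.
- by apply: continuous_subspaceT; apply: continuous_inv_normD; lra.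
- split.
  + by move=> y; rewrite in_itv/= => /andP[/ltW/dF[]].
  + by apply: cvg_at_right_filter; apply: cFF.
  + by apply: cvg_at_left_filter; apply: cFF; lra.
- move=> y; rewrite in_itv/= => /andP[y0 _]; rewrite derive1E ger0_norm ?ltW//.
  by apply: derive_val; apply: dF; exact: ltW.
Qed.

(* The defect [1 - G a] persists, by subadditivity, at one of [y] and [y + a]
   for every [y]; against the weight [1 / y] this costs a logarithm of [a]. *)
Lemma even_class_log_modulus X G C a : 0 <= X -> even_class X G -> 0 < a < 1 ->
  (\int[mu]_(x in `[0%R, +oo[) (sinh_integrand G x)%:E <= C%:E)%E ->
  (1 - G a) * - ln (2 * a) <= 4 * expR 1 * C.
Proof.
move=> X0 eG /andP[a0 a1] IC; have [cG _ _ G0 _] := eG.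
have e0 := expR_gt0 (1 : R).
(* The weight [1 / y] is regularized to [1 / (y + b)] and used with [b = a]. *)
pose u (b y : R) : R := (1 - G y) / (`|y| + b).
have den (b y : R) : 0 < b -> 0 < `|y| + b by move=> b0; have := normr_ge0 (y : R); lra.
have cu (b : R) : 0 < b -> continuous (u b).
  move=> b0 y; apply: cvgM; last exact: continuous_inv_normD.
  by apply: cvgB; [exact: cvg_cst|exact: cG].
have u0 (b y : R) : 0 < b -> 0 <= u b y.
  move=> b0; apply: divr_ge0; last exact/ltW/den.
  by rewrite subr_ge0 (even_class_le1 _ X0 eG).
(* On [[0, 1]], [2 sinh (y / 2) <= e y <= e (y + a)], so [u a] is at most [e] times the hyperbolic
   integrand. *)
have U : \int[mu]_(y in `[0, 1]) u a y <= expR 1 * C.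
  rewrite mulrC -ler_pdivrMr// mulrC.
  rewrite -RintegralZl//; last by apply: continuous_integrable_itv; exact: cu.
  have cu' : continuous (fun y => (expR 1)^-1 * u a y).
    by move=> y; apply: cvgM; [exact: cvg_cst|exact: cu].
  rewrite -lee_fin -Rintegral_EFin_itv//; apply: le_trans IC.
  have mf := measurable_sinh_integrand cG.
  have sub : `[0%R, 1%R] `<=` (`[0%R, +oo[ : set R).
    by move=> x /=; rewrite !in_itv/= andbT => /andP[].
  apply: (@le_trans _ _ (\int[mu]_(x in `[0%R, 1%R]) (sinh_integrand G x)%:E)%E); last first.
    apply: ge0_subset_integral => //; first exact/measurable_EFinP.
    by move=> x /=; rewrite in_itv/= andbT lee_fin => x0; exact: sinh_integrand_ge0 eG x0.
  apply: ge0_le_integral => //.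
  - by move=> x _; rewrite lee_fin mulr_ge0 ?u0// invr_ge0 ltW.
  - apply/measurable_EFinP; apply: measurable_funS (continuous_measurable_fun cu') => //.
  - by apply/measurable_EFinP; exact: measurable_funS mf.
  - move=> x /=; rewrite in_itv/= => /andP[x0 x1]; rewrite lee_fin.
    move: x0; rewrite le_eqVlt => /orP[/eqP <-|x0].
      by rewrite /u /sinh_integrand G0 subrr !mul0r mulr0.
    rewrite /u /sinh_integrand mulrCA ler_wpM2l ?subr_ge0 ?(even_class_le1 _ X0 eG)//.
    rewrite -invfM lef_pV2 ?posrE; last 2 first.
    + by rewrite mulr_gt0// den.
    + by rewrite mulr_gt0// sinhR_gt0// divr_gt0.
    rewrite (ger0_norm (ltW x0)).
    apply: (@le_trans _ _ (expR 1 * x)); first by apply: sinhR_half_le; rewrite (ltW x0).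
    by rewrite ler_pM2l//; lra.
have U1 : \int[mu]_(y in `[0, 1 - a]) u a y <= expR 1 * C.
  apply: le_trans U; rewrite (@Rintegral_itv_cat _ 0 (1 - a) 1); [|exact: cu|lra|lra].
  by rewrite lerDl; apply: Rintegral_ge0 => y _; exact: u0.
have U2 : \int[mu]_(y in `[0, 1 - a]) u a (y + a) <= expR 1 * C.
  apply: le_trans U; rewrite Rintegral_itv_shift; [|exact: cu|lra].
  rewrite add0r subrK (@Rintegral_itv_cat _ 0 a 1); [|exact: cu|lra|lra].
  by rewrite lerDr; apply: Rintegral_ge0 => y _; exact: u0.
have cw : continuous (fun y : R => (`|y| + 2 * a)^-1).
  by apply: continuous_inv_normD; lra.
have cua : continuous (fun y => u a (y + a)).
  move=> y; apply: (continuous_comp (f := fun y => y + a)); last exact: cu.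
  by apply: continuousD; [exact: cvg_id|exact: cst_continuous].
have dl : 0 <= 1 - G a by rewrite subr_ge0 (even_class_le1 _ X0 eG).
(* Subadditivity is divided by [y + 2 a], which is the denominator of [u a (y + a)] and exceeds that
   of [u a y]. For [y] in [[0, 1 - a]] both [y] and [y + a] stay in [[0, 1]], so each term is
   controlled by [U]. *)
have LU : (1 - G a) / 2 * (ln (1 + a) - ln (2 * a)) <= expR 1 * C + expR 1 * C.
  apply: le_trans (lerD U1 U2); rewrite -RintegralD//; last 2 first.
  - by apply: continuous_integrable_itv; exact: cu.
  - exact: continuous_integrable_itv.
  rewrite -Rintegral_inv_shift ?a0// -RintegralZl//; last exact: continuous_integrable_itv.
  apply: le_Rintegral => //.
  - by apply: continuous_integrable_itv => y; apply: cvgM; [exact: cvg_cst|exact: cw].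
  - by apply: continuous_integrable_itv => y; apply: cvgD; [exact: cu|exact: cua].
  move=> y /=; rewrite in_itv/= => /andP[y0 y1].
  have ya : 0 < y + 2 * a by lra.
  rewrite /u !ger0_norm//; last by lra.
  have -> : y + a + a = y + 2 * a by ring.
  have Gy : 0 <= 1 - G y by rewrite subr_ge0 (even_class_le1 _ X0 eG).
  apply: (@le_trans _ _ ((1 - G y) / (y + 2 * a) + (1 - G (y + a)) / (y + 2 * a))).
    rewrite -mulrDl ler_wpM2r ?invr_ge0 ?(ltW ya)//.
    by have := even_class_subadditive a y X0 eG; lra.
  by rewrite lerD2r ler_wpM2l// lef_pV2 ?posrE//; lra.
have : 0 <= (1 - G a) * ln (1 + a) by rewrite mulr_ge0// ln_ge0//; lra.
lra.
Qed.

(** If [a < exp (- L) / 2], the logarithmic estimate gives [1 - G a <= 4 e C / L]. The choice of [L]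
    makes this at most [eps^2 / 2], and Krein's inequality with [eta = eps / 2] concludes. The cap
    [1 / 2] on [d] ensures [a < 1]. *)
Lemma even_class_equicontinuous X C eps : 0 <= X -> 0 <= C -> 0 < eps ->
  exists2 d : R, 0 < d & forall G, even_class X G ->
    (\int[mu]_(x in `[0%R, +oo[) (sinh_integrand G x)%:E <= C%:E)%E ->
    forall x y, `|x - y| < d -> `|G x - G y| <= eps.
Proof.
move=> X0 C0 eps0; pose L := 8 * expR 1 * C / eps ^+ 2 + 1.
have e2 : 0 < eps ^+ 2 by rewrite exprn_gt0.
have L0 : 0 < L.
  by rewrite /L ltr_wpDl// divr_ge0 ?mulr_ge0 ?expR_ge0// ltW.
exists (Num.min (1 / 2) (expR (- L) / 2)).
  by rewrite lt_min !divr_gt0// expR_gt0.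
move=> G eG IC.
suff H x y : `|x - y| < Num.min (1 / 2) (expR (- L) / 2) -> G x - G y <= eps.
  move=> x y xy; rewrite ler_norml H// andbT lerNl opprB H// distrC//.
have [_ evG _ G0 _] := eG.
move=> xy; have [->|xny] := eqVneq x y; first by rewrite subrr ltW.
have GE : G (x - y) = G `|x - y| by case: (ger0P (x - y)) => // _; rewrite evG.
move: xy; rewrite lt_min => /andP[]; set a := `|x - y| => a1 aL.
have a0 : 0 < a by rewrite normr_gt0 subr_eq0.
have dl : 0 <= 1 - G a by rewrite subr_ge0 (even_class_le1 _ X0 eG).
have M : (1 - G a) * L <= 4 * expR 1 * C.
  have a01 : 0 < a < 1 by lra.
  apply: le_trans (even_class_log_modulus X0 eG a01 IC).
  rewrite ler_wpM2l// lerNr -[leRHS]expRK ler_ln ?posrE ?expR_gt0//; lra.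
have M2 : (1 - G a) <= eps ^+ 2 / 2.
  rewrite -(ler_pM2r L0); apply: le_trans M _.
  rewrite /L mulrDr mulr1.
  have -> : eps ^+ 2 / 2 * (8 * expR 1 * C / eps ^+ 2) = 4 * expR 1 * C.
    by field; rewrite gt_eqF.
  by rewrite lerDl divr_ge0// ltW.
have eh : 0 < eps / 2 by lra.
have := even_class_krein x y X0 eG eh; rewrite GE -/a => K.
rewrite -(ler_pM2l eps0); apply: le_trans (_ : _ <= 2 * (eps / 2) ^+ 2 + eps ^+ 2 / 2) _.
  by move: K; rewrite (_ : 2 * (eps / 2) = eps); [lra|field].
by rewrite !expr2; lra.
Qed.

End even_class.

(** * Compactness of the class and semicontinuity of the hyperbolic sine integral *)

Section compactness.
Variable R : realType.
Local Notation mu := (@lebesgue_measure R).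
Implicit Types (G H : R -> R) (X x y e c : R).

Lemma ultra_bounded_cvg (U : set_system nat) (u : nat -> R) c : UltraFilter U ->
  (forall n, `|u n| <= c) -> exists l : R, u n @[n --> U] --> l.
Proof.
move=> UU uc; have PU : ProperFilter U by exact: ultra_proper.
have [|l [_ cl]] := @segment_compact R (- c) c (u n @[n --> U]).
  have : U (u @^-1` `[- c, c]).
    by apply: (filterS _ filterT) => n _ /=; rewrite in_itv/= -ler_norml.
  exact.
exists l => B nB; have [//|nU] := in_ultra_setVsetC (u @^-1` B) UU.
by have [z []] := cl (~` B) B nU nB.
Qed.

(** This is Arzelà-Ascoli along an ultrafilter finer than [\oo]: bounded values converge at all
    points simultaneously, with no diagonal extraction. Equicontinuity passes to the limit and makes
    the convergence uniform. As [U] contains every tail, indices beyond any [k] are available. *)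
Lemma even_class_compact X (Gn : nat -> R -> R) : 0 <= X ->
  (forall n, even_class X (Gn n)) ->
  (forall e, 0 < e -> exists2 d : R, 0 < d &
     forall n x y, `|x - y| < d -> `|Gn n x - Gn n y| <= e) ->
  exists2 G, even_class X G & forall e, 0 < e ->
    forall k, exists n, (k <= n)%N /\ forall x, `|Gn n x - G x| <= e.
Proof.
move=> X0 eGn eqc; have [U [UU sU]] := @ultraFilterLemma nat \oo _.
have PU : ProperFilter U by exact: ultra_proper.
have bd n x : `|Gn n x| <= 1.
  by rewrite ler_norml (even_class_geN1 _ X0 (eGn n)) (even_class_le1 _ X0 (eGn n)).
have /choice[G GP] : forall x, exists l : R, Gn n x @[n --> U] --> l.
  by move=> x; apply: (@ultra_bounded_cvg _ _ 1) => n; exact: bd.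
have near1 x e : 0 < e -> U [set n | `|Gn n x - G x| < e].
  move=> e0; have /cvgrPdist_lt/(_ _ e0) := GP x.
  by apply: filterS => n /=; rewrite distrC.
have eqG e : 0 < e -> exists2 d : R, 0 < d &
    (forall n x y, `|x - y| < d -> `|Gn n x - Gn n y| <= e) /\
    (forall x y, `|x - y| < d -> `|G x - G y| <= e).
  move=> /eqc[d d0 dP]; exists d => //; split => // x y xy.
  apply/ler_addgt0Pr => r r0; have r2 : 0 < r / 2 by lra.
  have [n [/= nx ny]] := filter_ex (filterI (near1 x _ r2) (near1 y _ r2)).
  have -> : G x - G y = - (Gn n x - G x) + (Gn n x - Gn n y) + (Gn n y - G y) by ring.
  apply: le_trans (ler_normD _ _) _.
  apply: le_trans (lerD (ler_normD _ _) (lexx _)) _; rewrite normrN.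
  by have := dP n x y xy; lra.
have lim_eq x l : (forall n, Gn n x = l) -> G x = l.
  move=> E; have Gx := GP x.
  have cl : Gn n x @[n --> U] --> l.
    have -> : (fun n => Gn n x) = cst l by exact/funext.
    exact: cvg_cst.
  by have := cvg_unique _ Gx cl; exact.
have cG : continuous G.
  move=> x; apply/cvgrPdist_le => e e0; have [d d0 [_ dP]] := eqG e e0.
  by apply/nbhs_ballP; exists d => //= y; rewrite /ball/= => /dP.
have sG y : X <= `|y| -> G y = 0 by move=> Xy; apply: lim_eq => n; have [_ _ sn _ _] := eGn n; exact: sn.
have evG y : G (- y) = G y.
  have Gx := GP (- y); have cl : Gn n (- y) @[n --> U] --> G y.
    have -> : (fun n => Gn n (- y)) = (fun n => Gn n y); last exact: GP.
    by apply/funext => n; have [_ evn _ _ _] := eGn n; exact: evn.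
  by have := cvg_unique _ Gx cl; exact.
have unif e : 0 < e -> U [set n | forall x, `|Gn n x - G x| <= e].
  move=> e0; have e3 : 0 < e / 3 by lra.
  have [d d0 [dn dG]] := eqG _ e3.
  (* Near each [x], a ball and a [U]-large set of indices give the bound; near-covering compactness
     merges these into one [U]-large set for all of [[-X, X]]. *)
  have nc := proj1 (compact_near_coveringP _) (@segment_compact R (- X) X).
  have : U [set n | `[- X, X] `<=` (fun x => `|Gn n x - G x| <= e)].
    apply: nc => x _; exists (ball x d, [set n | `|Gn n x - G x| < e / 3]).
      by split; [exact: nbhsx_ballx|exact: near1].
    move=> [x' n]/= [xx' nx].
    have -> : Gn n x' - G x' = - (Gn n x - Gn n x') + (Gn n x - G x) + (G x - G x') by ring.
    apply: le_trans (ler_normD _ _) _.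
    apply: le_trans (lerD (ler_normD _ _) (lexx _)) _; rewrite normrN.
    have := dn n x x' xx'; have := dG x x' xx'; lra.
  apply: filterS => n /= nX x; have [xX|xX] := leP X `|x|.
    by have [_ _ sn _ _] := eGn n; rewrite sn// sG// subrr normr0 ltW.
  by apply: nX; rewrite /= in_itv/= -ler_norml ltW.
exists G; last first.
  move=> e e0 k; have Uk : U [set n | (k <= n)%N] by apply: sU; exists k.
  by have [n [/= kn nG]] := filter_ex (filterI Uk (unif e e0)); exists n.
split=> //; first by apply: lim_eq => n; have [_ _ _ n0 _] := eGn n; exact: n0.
move=> t.
have cc (F : R -> R) : continuous F -> continuous (fun y => F y * cos (t * y)).
  by move=> cF y; apply: cvgM; [exact: cF|exact: continuous_cosZ].
apply/ler_addgt0Pr => r r0.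
(* This uniform error, integrated over a length [X], costs at most [r]; the [+ 1] covers [X = 0]. *)
have e0 : 0 < r / (X + 1) by rewrite divr_gt0//; lra.
have [n /= nG] := filter_ex (unif _ e0).
have [cGn _ _ _ hGn] := eGn n.
apply: le_trans (hGn t) _; rewrite -lerBlDl -RintegralB//; last 2 first.
- by apply: continuous_integrable_itv; exact: cc.
- by apply: continuous_integrable_itv; exact: cc.
apply: (@le_trans _ _ (r / (X + 1) * (X - 0))).
  apply: Rintegral_itv_le_cst => //.
    by move=> y; apply: cvgB; exact: cc.
  move=> y _; rewrite -mulrBl; apply: le_trans (ler_norm _) _; rewrite normrM.
  rewrite -[leRHS]mulr1; apply: ler_pM => //.
  by rewrite ler_norml cos_geN1 cos_le1.
rewrite subr0 mulrAC ler_pdivrMr; last by lra.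
by rewrite ler_wpM2l ?(ltW r0)//; lra.
Qed.

(** The integral enters [l] with a minus sign, so its lower semicontinuity is the direction that a
    maximum calls for. *)
Lemma sinh_integral_fatou X (Gn : nat -> R -> R) G (l : R) : 0 <= X ->
  (forall n, even_class X (Gn n)) -> (forall x, Gn n x @[n --> \oo] --> G x) ->
  (forall n, (\int[mu]_(x in `[0%R, +oo[) (sinh_integrand (Gn n) x)%:E <= l%:E)%E) ->
  (\int[mu]_(x in `[0%R, +oo[) (sinh_integrand G x)%:E <= l%:E)%E.
Proof.
move=> X0 eGn cGn Il.
have -> : (\int[mu]_(x in `[0%R, +oo[) (sinh_integrand G x)%:E =
    \int[mu]_(x in `[0%R, +oo[) limn_einf (fun n => (sinh_integrand (Gn n) x)%:E))%E.
  apply: eq_integral => x _; apply/esym.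
  have : (sinh_integrand (Gn n) x)%:E @[n --> \oo] --> (sinh_integrand G x)%:E.
    apply: cvg_EFin; first by apply: nearW.
    by apply: cvgMl; apply: cvgB; [exact: cvg_cst|exact: cGn].
  by move/cvg_limn_einf_sup => [].
apply: le_trans (fatou _ _ _ _) _ => //.
- move=> n; apply/measurable_EFinP; apply: measurable_sinh_integrand.
  by have [] := eGn n.
- move=> n x /=; rewrite in_itv/= andbT lee_fin => x0.
  exact: sinh_integrand_ge0 (eGn n) x0.
rewrite limn_einf_lim; apply: lime_le.
  exact: is_cvg_einfs.
apply: nearW => n; apply: ge_ereal_inf; exists (\int[mu]_(x in `[0%R, +oo[) (sinh_integrand (Gn n) x)%:E)%E => //.
by exists n => /=.
Qed.

End compactness.

(** * Decomposition of [l] into a Lipschitz part and the hyperbolic sine integral *)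

Section functional.
Variable R : realType.
Local Notation mu := (@lebesgue_measure R).
Implicit Types (G H : R -> R) (X x y e : R) (D : int).

Definition prime_coef D (n : nat) : R :=
  vonMangoldt R n * (kronecker D n)%:~R / Num.sqrt (n%:R).

Definition cosh_integral X G : R :=
  \int[mu]_(x in `[0, X]) (G x / (2 * coshR (x / 2))).

(* The part of [l] other than the hyperbolic sine integral; [N] truncates the
   prime sum beyond the support. *)
Definition bounded_part D X (N : nat) G : R :=
  2 * (\sum_(1 <= n < N) prime_coef D n * G (ln n%:R)) +
  ln (8 * pi * expR (euler_gamma R)) + (kronecker_m1 D)%:~R * cosh_integral X G.

Lemma coshR_ge1 x : 1 <= coshR x.
Proof.
by rewrite /coshR; have := expR_ge1Dx x; have := expR_ge1Dx (- x); lra.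
Qed.

Lemma continuous_cosh_integrand G : continuous G ->
  continuous (fun x => G x / (2 * coshR (x / 2))).
Proof.
move=> cG x; have ch : continuous (fun y : R => y / 2).
  by move=> y; apply: cvgM; [exact: cvg_id|exact: cvg_cst].
have ce : continuous (fun y : R => expR (y / 2)).
  by move=> y; apply: continuous_comp; [exact: ch|exact: continuous_expR].
have cn : continuous (fun y : R => expR (- (y / 2))).
  by move=> y; apply: continuous_comp; [apply: cvgN; exact: ch|exact: continuous_expR].
apply: cvgM; first exact: cG.
apply: cvgV; first by rewrite gt_eqF//; have := coshR_ge1 (x / 2); lra.
apply: cvgM; first exact: cvg_cst.
by apply: cvgM; [apply: cvgD; [exact: ce|exact: cn]|exact: cvg_cst].
Qed.

Lemma cosh_integral_lipschitz X G H e : 0 <= X -> continuous G -> continuous H ->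
  (forall x, `|G x - H x| <= e) -> `|cosh_integral X G - cosh_integral X H| <= X * e.
Proof.
move=> X0 cG cH GHe.
suff main F F' : continuous F -> continuous F' -> (forall x, `|F x - F' x| <= e) ->
    cosh_integral X F - cosh_integral X F' <= X * e.
  rewrite ler_norml main// andbT lerNl opprB main// => x.
  by rewrite distrC.
move=> {}cG {}cH {}GHe; rewrite /cosh_integral -RintegralB//; last 2 first.
- by apply: continuous_integrable_itv; exact: continuous_cosh_integrand.
- by apply: continuous_integrable_itv; exact: continuous_cosh_integrand.
rewrite mulrC -{2}(subr0 X); apply: Rintegral_itv_le_cst => //.
  by move=> y; apply: cvgB; exact: continuous_cosh_integrand.
move=> y _; have c1 := coshR_ge1 (y / 2).
have e0 : 0 <= e by apply: le_trans (GHe 0).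
rewrite -mulrBl ler_pdivrMr; last by lra.
apply: le_trans (le_trans (ler_norm _) (GHe y)) _.
by rewrite ler_peMr//; lra.
Qed.

(** The truncated prime sum has finitely many terms and the hyperbolic cosine weight is at most 1.
    The sign of the cosine term may be negative, hence the use of both sides of its Lipschitz
    bound. *)
Lemma bounded_part_lipschitz D X N G H e : 0 <= X -> continuous G -> continuous H ->
  (forall x, `|G x - H x| <= e) ->
  bounded_part D X N G - bounded_part D X N H <=
  (2 * (\sum_(1 <= n < N) `|prime_coef D n|) + X) * e.
Proof.
move=> X0 cG cH GHe.
have S : \sum_(1 <= n < N) prime_coef D n * G (ln n%:R) -
    \sum_(1 <= n < N) prime_coef D n * H (ln n%:R) <=
    (\sum_(1 <= n < N) `|prime_coef D n|) * e.
  rewrite -sumrB mulr_suml; apply: ler_sum => n _; rewrite -mulrBr.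
  by apply: le_trans (ler_norm _) _; rewrite normrM ler_wpM2l.
have := cosh_integral_lipschitz X0 cG cH GHe; rewrite ler_norml => /andP[J1 J2].
rewrite /bounded_part /kronecker_m1; case: ifP => _ /=.
  by rewrite mulrN1z mulrDl -mulrA; lra.
by rewrite mulr1z mulrDl -mulrA; lra.
Qed.

(** An index [i >= N >= exp X] has [ln i >= X], where [G] vanishes. The partial sums of the prime
    series are therefore constant from [N] on, and their limit is the truncated sum. *)
Lemma lfunE D X N G : 0 <= X -> expR X <= N%:R -> even_class X G ->
  lfun D G = ((bounded_part D X N G)%:E -
    \int[mu]_(x in `[0%R, +oo[) (sinh_integrand G x)%:E)%E.
Proof.
move=> X0 XN [cG _ sG _ _].
rewrite /lfun (@integral_bounded_support _ X (fun x => G x / (2 * coshR (x / 2)))); last first.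
  by move=> y Xy; rewrite sG ?mul0r// (le_trans Xy)// ler_norm.
rewrite Rintegral_EFin_itv; last exact: continuous_cosh_integrand.
rewrite -EFinM addeAC -EFinD; congr (_%:E - _)%E; rewrite /bounded_part.
congr (2 * _ + _ + _); apply: lim_near_cst => //.
have N0 : (1 <= N)%N.
  by rewrite -(ltr_nat R); apply: lt_le_trans XN; exact: expR_gt0.
exists N => // n /= Nn; rewrite (big_cat_nat N0 Nn)/= [X in _ + X]big_nat_cond [X in _ + X]big1 ?addr0//.
move=> i /andP[/andP[Ni _] _]; rewrite sG ?mulr0//.
apply: le_trans (ler_norm _).
have Ni' : expR X <= i%:R by rewrite (le_trans XN)// ler_nat.
by rewrite -[leLHS]expRK ler_ln ?posrE ?expR_gt0// (lt_le_trans (expR_gt0 X)).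
Qed.

Lemma lfun_even_extension D (g : R -> R) : lfun D g = lfun D (fun y => g `|y|).
Proof.
have E : (fun N => \sum_(1 <= n < N) prime_coef D n * g (ln n%:R)) =
    (fun N => \sum_(1 <= n < N) prime_coef D n * g `|ln n%:R|).
  apply/funext => N; apply: eq_big_nat => n /andP[n1 _]; rewrite ger0_norm// ln_ge0//.
  by rewrite ler1n.
rewrite /lfun E; congr (_ - _ + _ * _)%E.
- by apply: eq_integral => x; rewrite inE/= in_itv/= andbT => x0; rewrite ger0_norm.
- by apply: eq_integral => x; rewrite inE/= in_itv/= andbT => x0; rewrite ger0_norm.
Qed.

End functional.

(** * Existence of a maximizer by the direct method *)

Theorem proposition2p1 (R : realType) (D : int) (X : R) :
  fundamental_discriminant D -> D != 1 -> 0 < X ->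
  exists gX : R -> R, classC X gX /\
    (forall g : R -> R, classC X g -> (lfun D g <= lfun D gX)%E).
Proof.
move=> _ _ X0; have X0' := ltW X0.
suff [G eG Gmax] : exists2 G, even_class X G &
    forall H, even_class X H -> (lfun D H <= lfun D G)%E.
  exists G; split; first exact: even_class_classC.
  move=> g cg; rewrite lfun_even_extension; apply: Gmax.
  exact: classC_even_class.
have [[G0 [eG0 lG0]]|none] :=
    pselect (exists G, even_class X G /\ lfun D G != -oo%E); last first.
  have [G eG] := even_class_nonempty X0; exists G => // H eH.
  suff -> : lfun D H = -oo%E by exact: leNye.
  by apply/eqP/negPn/negP => lH; apply: none; exists H.
have [N XN] : exists N, expR X <= N%:R.
  exists (Num.truncn (expR X)).+1; apply: ltW; exact: truncnS_gt.
pose A := bounded_part D X N.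
pose I (G : R -> R) := (\int[@lebesgue_measure R]_(x in `[0%R, +oo[) (sinh_integrand G x)%:E)%E.
have lE G : even_class X G -> lfun D G = ((A G)%:E - I G)%E by exact: lfunE.
have I0 G : even_class X G -> (0 <= I G)%E.
  move=> eG; apply: integral_ge0 => x /=; rewrite in_itv/= andbT lee_fin => x0.
  exact: sinh_integrand_ge0 eG x0.
pose K := 2 * (\sum_(1 <= n < N) `|prime_coef R D n|) + X.
have K0 : 0 <= K by rewrite addr_ge0// mulr_ge0// sumr_ge0.
(* Members of the class are within 1 of the zero function, so the Lipschitz bound caps [A] on the
   whole class. *)
pose M := A (cst 0) + K.
have AM G : even_class X G -> A G <= M.
  move=> eG; have [cG _ _ _ _] := eG.
  rewrite /M -lerBlDl -[leRHS]mulr1; apply: bounded_part_lipschitz => //.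
    by move=> x; exact: cst_continuous.
  move=> x; rewrite subr0 ler_norml.
  by rewrite (even_class_geN1 _ X0' eG) (even_class_le1 _ X0' eG).
pose S := [set lfun D G | G in even_class X].
have sfin : ereal_sup S \is a fin_num.
  rewrite fin_numElt; apply/andP; split.
    apply: (@lt_le_trans _ _ (lfun D G0)); first by rewrite ltNye.
    by apply: ereal_sup_ubound; exists G0.
  apply: (@le_lt_trans _ _ M%:E); last exact: ltry.
  apply: ge_ereal_sup => _ [G eG <-]; rewrite lE//.
  apply: (@le_trans _ _ (A G)%:E); last by rewrite lee_fin AM.
  by rewrite geeDl// oppe_le0 I0.
pose r := fine (ereal_sup S).
have rE : r%:E = ereal_sup S by rewrite fineK.
(* The near-maximality [l (Gn n) > r - 1 / (n + 1)] is recast as an upper bound on the hyperbolic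
   integral, the form that passes through Fatou's lemma. *)
have /choice[Gn GnP] : forall n, exists G, even_class X G /\
    (I G <= (A G - r + n.+1%:R^-1)%:E)%E.
  move=> n; have n0 : 0 < (n.+1%:R^-1 : R) by rewrite invr_gt0.
  move: (n.+1%:R^-1 : R) n0 => q q0.
  have [_ [G eG <-]] := ub_ereal_sup_adherent q0 sfin.
  rewrite -rE lE// => lt; exists G; split=> //; move: lt; move: (A G) => a.
  case: (I G) => [i| |]; last by rewrite leNye.
    by rewrite -!EFinB lte_fin lee_fin; lra.
  by rewrite -EFinB; case.
have eGn n : even_class X (Gn n) by have [] := GnP n.
have IGn n : (I (Gn n) <= (A (Gn n) - r + n.+1%:R^-1)%:E)%E by have [] := GnP n.
pose C := M - r + 1.
have IC n : (I (Gn n) <= C%:E)%E.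
  apply: le_trans (IGn n) _; rewrite lee_fin /C lerD ?lerD2r ?AM//.
  by rewrite invf_le1// ler1n.
have C0 : 0 <= C by rewrite -lee_fin; apply: le_trans (IC 0%N); exact: I0.
have [|G eG GP] := even_class_compact X0' eGn.
  move=> e e0; have [d d0 dP] := even_class_equicontinuous X0' C0 e0.
  by exists d => // n; apply: dP => //; exact: IC.
have [cG _ _ _ _] := eG.
exists G => // H eH; apply: (@le_trans _ _ r%:E).
  by rewrite rE; apply: ereal_sup_ubound; exists H.
suff IG : (I G <= (A G - r)%:E)%E.
  rewrite lE//; move: IG (I0 _ eG); case: (I G) => [i| |]//.
  by rewrite -EFinB !lee_fin; lra.
apply/lee_addgt0Pr => e e0; rewrite -EFinD.
(* The budget is [e = K e' + e']: the first term pays for the variation of [A], the second for the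
   defect [1 / (n + 1)]. *)
pose e' := e / (K + 1).
have e'0 : 0 < e' by rewrite divr_gt0//; lra.
have [N1 _ N1P] := near_infty_natSinv_lt (PosNum e'0).
(* [phi] may fail to be increasing. The bound [N1 <= phi k] keeps the defect below [e'], and the
   minimum gives both the uniform error [e'] and pointwise convergence as [k] grows. *)
have /choice[phi phiP] : forall k, exists n,
    (N1 <= n)%N /\ forall x, `|Gn n x - G x| <= Num.min e' k.+1%:R^-1.
  by move=> k; apply: GP; rewrite lt_min e'0/= invr_gt0.
apply: (@sinh_integral_fatou _ X (fun k => Gn (phi k))) => //.
  move=> x; apply/cvgrPdist_lt => eps eps0.
  have /cvgrPdist_lt/(_ _ eps0) := @cvg_harmonic R.
  apply: filterS => k; rewrite sub0r normrN => kl.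
  rewrite distrC; apply: le_lt_trans (_ : _ <= k.+1%:R^-1) _.
    by have [_ /(_ x)] := phiP k; rewrite le_min => /andP[].
  by apply: le_lt_trans kl; exact: ler_norm.
move=> k; have [kN1 kG] := phiP k; apply: le_trans (IGn _) _; rewrite lee_fin.
have [cGk _ _ _ _] := eGn (phi k).
have L : A (Gn (phi k)) - A G <= K * e'.
  apply: bounded_part_lipschitz => // x.
  by have := kG x; rewrite le_min => /andP[].
have iN := ltW (N1P _ kN1).
have Ke : K * e' + e' = e.
  by rewrite /e'; field; rewrite gt_eqF//; lra.
rewrite -Ke; move: L iN => /=; move: (K * e') (A G) (A _) (_^-1) => u v w q; lra.
Qed.
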